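(* Let $K\subset\mathbb{C}$ be a field and let $p(x)\in K[x]$ be a polynomial with distinct roots $r_1,\dots,r_n\in\mathbb{C}$. Let $V$ be a resolvent of $p$ with coefficients in $K$, let $V_0=V(r_1,\dots,r_n)$, and let $V_0,V_1,\dots,V_m$ be all the roots of the irreducible factor over $K$ of the auxiliary polynomial of $p$ having $V_0$ as a root. Let $F_1,\dots,F_n$ be rational functions over $K$ in one variable, with denominators not vanishing at $V_0$, such that $F_i(V_0)=r_i$ for $i=1,\dots,n$. Then each row of the table $$\begin{array}{cccc}F_1(V_0)&F_2(V_0)&\cdots&F_n(V_0)\\ F_1(V_1)&F_2(V_1)&\cdots&F_n(V_1)\\ \vdots&\vdots&&\vdots\\ F_1(V_m)&F_2(V_m)&\cdots&F_n(V_m)\end{array}$$ is a permutation of $r_1,\dots,r_n$, and the set of permutations $r_i\mapsto F_i(V_j)$, $j=0,\dots,m$, is the Galois group of $p$ over $K$. Moreover, a function $f(r_1,\dots,r_n)$ of the roots is known if and only if it is invariant under all these permutations, that is, if and only if $f(F_1(V_j),\dots,F_n(V_j))=f(r_1,\dots,r_n)$ for all $j=0,\dots,m$.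
   Context: A resolvent of $p$ with coefficients in $K$ is an expression $V(r_1,\dots,r_n)=a_1r_1+\dots+a_nr_n$ with $a_i\in K$ such that the $n!$ values $V(r_{\sigma(1)},\dots,r_{\sigma(n)})$, $\sigma\in S_n$, are pairwise distinct. The auxiliary polynomial is $\prod_{\sigma\in S_n}\bigl(X-V(r_{\sigma(1)},\dots,r_{\sigma(n)})\bigr)\in K[X]$. A ''function of the roots'' is given by a rational function $f$ in $n$ variables over $K$ whose denominator does not vanish at any $(r_{\sigma(1)},\dots,r_{\sigma(n)})$, $\sigma\in S_n$. It is ''known'' if its value $f(r_1,\dots,r_n)$ lies in $K$. It is invariant under a permutation $\sigma$ if $f(r_{\sigma(1)},\dots,r_{\sigma(n)})=f(r_1,\dots,r_n)$ (equality of values in $\mathbb{C}$). The Galois group of $p$ over $K$ is the maximum group of permutations of the roots under which every known function of the roots is invariant, i.e. the group of all permutations $\sigma$ of the roots such that every known function of the roots is invariant under $\sigma$. *)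

(* Defs.v *)
From HB Require Import structures.
From mathcomp Require Import all_boot all_order all_algebra all_fingroup.
From mathcomp Require Import reals complex mpoly.

Set Implicit Arguments.
Unset Strict Implicit.
Unset Printing Implicit Defensive.

Import Order.TTheory GRing.Theory Num.Theory.
Local Open Scope ring_scope.

(* Throughout, K is a subfield of C with underlying set S, and \val is the
   inclusion of K in C.  Lists of n roots are functions 'I_n -> C, and a
   permutation s of the roots r_i is given by the permutation i |-> s i of
   their indices, so that r \o s is the list r_(s 0), ..., r_(s (n - 1)). *)
Section Galois.
Variables (C : fieldType) (S : {pred C}) (K : subFieldType S).

Definition poly_in_C (p : {poly K}) : {poly C} := map_poly (\val : K -> C) p.

Definition has_distinct_roots n (p : {poly K}) (r : 'I_n -> C) : Prop :=
  [/\ p != 0, injective r &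
      poly_in_C p = lead_coef (poly_in_C p) *: \prod_(i < n) ('X - (r i)%:P)].

Definition ratio_defined (F : {ratio {poly K}}) (z : C) : Prop :=
  (poly_in_C \d_F).[z] != 0.

Definition ratio_eval (F : {ratio {poly K}}) (z : C) : C :=
  (poly_in_C \n_F).[z] / (poly_in_C \d_F).[z].

Definition mratio_defined n (f : {ratio {mpoly K[n]}}) (x : 'I_n -> C) : Prop :=
  (map_mpoly (\val : K -> C) \d_f).@[x] != 0.

Definition mratio_eval n (f : {ratio {mpoly K[n]}}) (x : 'I_n -> C) : C :=
  (map_mpoly (\val : K -> C) \n_f).@[x] / (map_mpoly (\val : K -> C) \d_f).@[x].

Definition lin_form n (a : 'I_n -> K) (x : 'I_n -> C) : C :=
  \sum_(i < n) (\val (a i) : C) * x i.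

Definition is_resolvent n (r : 'I_n -> C) (a : 'I_n -> K) : Prop :=
  injective (fun s : 'S_n => lin_form a (r \o s)).

Definition auxiliary_poly n (r : 'I_n -> C) (a : 'I_n -> K) : {poly C} :=
  \prod_(s : 'S_n) ('X - (lin_form a (r \o s))%:P).

Definition function_of_roots n (r : 'I_n -> C) (f : {ratio {mpoly K[n]}}) : Prop :=
  forall s : 'S_n, mratio_defined f (r \o s).

Definition known n (r : 'I_n -> C) (f : {ratio {mpoly K[n]}}) : Prop :=
  mratio_eval f r \in S.

Definition invariant_under n (r : 'I_n -> C) (f : {ratio {mpoly K[n]}})
    (s : 'S_n) : Prop :=
  mratio_eval f (r \o s) = mratio_eval f r.

Definition is_galois_group n (r : 'I_n -> C) (G : {set 'S_n}) : Prop :=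
  group_set G /\
  forall s : 'S_n, s \in G <->
    forall f, function_of_roots r f -> known r f -> invariant_under r f s.

End Galois.

(* Main.v *)
(** Because [g] is irreducible, a polynomial over K that vanishes at [V_0]
    vanishes at every [V_j].  Inverting denominators modulo [g], write
    [F_i(V_j) = Q_i(V_j)] with [Q_i] in K[X].  Then [p(Q_i)] vanishes at [V_0],
    hence at every [V_j], and [Q_i - Q_k] vanishes at no [V_j] unless [i = k];
    so each row of the table is a permutation of the roots.  A function of the
    roots is likewise [h(V_j)] on row [j] for some [h] in K[X]; as [g] has as many
    simple roots as its degree, [h] modulo [g] is constant exactly when [h(V_j)]
    does not depend on [j].  Since [V_j] is the resolvent evaluated on row [j], the
    permutations [s] in the table are those for which [g] vanishes at the resolvent
    permuted by [s], and this value of [g] is itself a known function of the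
    roots. *)

Require Import Defs.
From HB Require Import structures.
From mathcomp Require Import all_boot all_order all_algebra all_fingroup.
From mathcomp Require Import reals complex mpoly.

Set Implicit Arguments.
Unset Strict Implicit.
Unset Printing Implicit Defensive.

Import Order.TTheory GRing.Theory Num.Theory.
Local Open Scope ring_scope.

Section Conjugates.
Context {C : fieldType} {S : {pred C}} {K : subFieldType S}.
Implicit Types (g h d : {poly K}) (F : {ratio {poly K}}) (z w : C).

Local Notation "p ^C" := (poly_in_C p) : ring_scope.

(** The gcd is unchanged by extension from K to C, and there it vanishes at [z], so it is not
    constant; irreducibility then makes it associate to [g]. *)
Lemma irreducible_root_dvdp g h z :
  irreducible_poly g -> root g^C z -> root h^C z -> g %| h.
Proof.
move=> [_ g_irr] gz hz.
have gcd_size : size (gcdp g h) != 1%N.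
  apply/negP=> /size_poly1P[c c0 gcdE].
  have : root (gcdp g^C h^C) z by rewrite root_gcd gz hz.
  by rewrite -gcdp_map gcdE map_polyC rootC fmorph_eq0 (negPf c0).
by rewrite -(eqp_dvdl _ (g_irr _ gcd_size (dvdp_gcdl g h))) dvdp_gcdr.
Qed.

Lemma irreducible_root_conj g h z w :
  irreducible_poly g -> root g^C z -> root g^C w -> root h^C z -> root h^C w.
Proof.
move=> g_irr gz gw hz; have /dvdpP[q ->] := irreducible_root_dvdp g_irr gz hz.
by rewrite /poly_in_C rmorphM rootM gw orbT.
Qed.

(** The Bezout relation [u * d + v * g = 1] loses its second term at every root of [g], so one [u]
    inverts [d] at all conjugates of [z] at once. *)
Lemma irreducible_inverse g d z :
  irreducible_poly g -> root g^C z -> ~~ root d^C z ->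
  exists u : {poly K}, forall w, root g^C w -> (u^C).[w] * (d^C).[w] = 1.
Proof.
move=> g_irr gz dz.
have /Bezout_eq1_coprimepP[[u v] /= uvE] : coprimep d g.
  rewrite coprimep_sym irreducible_poly_coprime //.
  apply: contra dz => /dvdpP[q ->].
  by rewrite /poly_in_C rmorphM rootM gz orbT.
exists u => w /rootP gw.
have := congr1 (fun q : {poly K} => (q^C).[w]) uvE.
rewrite /poly_in_C rmorphD !rmorphM rmorph1 /= !hornerE.
by rewrite [(map_poly _ g).[w]]gw mulr0 addr0.
Qed.

Lemma ratio_eval_poly g F z :
  irreducible_poly g -> root g^C z -> ratio_defined F z ->
  exists q : {poly K}, forall w, root g^C w ->
    ratio_defined F w /\ ratio_eval F w = (q^C).[w].
Proof.
move=> g_irr gz Fz.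
have [u uP] := irreducible_inverse g_irr gz Fz.
exists (\n_F * u) => w gw; have uw := uP w gw.
have dw : (poly_in_C \d_F).[w] != 0.
  by apply/eqP=> dw0; move/eqP: uw; rewrite dw0 mulr0 eq_sym oner_eq0.
split=> //; rewrite /ratio_eval /poly_in_C rmorphM hornerM.
by apply: (canLR (mulfK dw)); rewrite -mulrA uw mulr1.
Qed.

Section FunctionsOfPolynomials.
Context {n : nat}.
Implicit Types (P : {mpoly K[n]}) (Q : 'I_n -> {poly K}).

(** This turns a polynomial function of a row of the table into a single polynomial over K evaluated
    at the conjugate [w]. *)
Lemma meval_mmap_polyC P Q w :
  ((mmap (@polyC K) Q P)^C).[w]
    = (map_mpoly (\val : K -> C) P).@[fun i => ((Q i)^C).[w]].
Proof.
elim/mpolyind: P => [|c m P _ _ IH].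
  by rewrite /poly_in_C !raddf0 horner0.
rewrite mmapD mmapZ mmapX /mmap1 /poly_in_C rmorphD rmorphM hornerD.
rewrite -/(poly_in_C _) IH raddfD mevalD /=; congr (_ + _).
rewrite map_mpolyZ mevalZ map_mpolyX mevalX hornerM map_polyC hornerC.
rewrite rmorph_prod horner_prod; congr (_ * _).
by apply: eq_bigr => i _; rewrite rmorphXn horner_exp.
Qed.

Lemma mratio_eval_poly g (f : {ratio {mpoly K[n]}}) Q z :
  irreducible_poly g -> root g^C z ->
  mratio_defined f (fun i => ((Q i)^C).[z]) ->
  exists h : {poly K}, forall w, root g^C w ->
    mratio_eval f (fun i => ((Q i)^C).[w]) = (h^C).[w].
Proof.
move=> g_irr gz; rewrite /mratio_defined -meval_mmap_polyC => fz.
have [u uP] := irreducible_inverse g_irr gz fz.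
exists (mmap (@polyC K) Q \n_f * u) => w gw; have uw := uP w gw.
rewrite /mratio_eval -!meval_mmap_polyC /poly_in_C rmorphM hornerM.
apply: (canLR (mulfK _)); last by rewrite -mulrA uw mulr1.
by apply/eqP=> dw0; move/eqP: uw; rewrite dw0 mulr0 eq_sym oner_eq0.
Qed.

Lemma eq_mratio_eval (f : {ratio {mpoly K[n]}}) (x y : 'I_n -> C) :
  x =1 y -> mratio_eval f x = mratio_eval f y.
Proof. by move=> xy; rewrite /mratio_eval !(meval_eq _ xy). Qed.

Lemma eq_mratio_defined (f : {ratio {mpoly K[n]}}) (x y : 'I_n -> C) :
  x =1 y -> mratio_defined f x = mratio_defined f y.
Proof. by move=> xy; rewrite /mratio_defined (meval_eq _ xy). Qed.

End FunctionsOfPolynomials.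

(** Up to a unit, [q] is a product of some of the distinct linear factors, so its degree is its
    number of roots, all of which occur among the [m] values of [V]. *)
Lemma size_dvdp_prod_XsubC (I : finType) (x : I -> C) (q : {poly C})
    m (V : 'I_m -> C) :
  injective x -> q %| \prod_i ('X - (x i)%:P) ->
  (forall z, root q z -> exists j, V j = z) -> (size q <= m.+1)%N.
Proof.
move=> x_inj q_dvd q_roots.
have [b qE] := dvdp_prod_XsubC q_dvd.
rewrite (eqp_size qE) size_prod_XsubC ltnS -(size_map x).
rewrite -[m in leqRHS]card_ord cardE -(size_map V).
apply: uniq_leq_size.
  by rewrite (map_inj_uniq x_inj) mask_uniq // index_enum_uniq.
move=> z zb; have /q_roots[j <-] : root q z.
  by rewrite (eqp_root qE) -(big_map x xpredT (fun y => 'X - y%:P)) root_prod_XsubC.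
by rewrite map_f // mem_enum.
Qed.

(** If the value at [V ord0] is some [c] in K, then [h - c] vanishes at one root of [g], hence at
    every [V j]. Conversely, the remainder of [h] modulo [g] has degree at most [m] and takes one
    value at [m + 1] distinct points; it is therefore constant, and its constant coefficient lies in
    K. *)
Lemma conj_horner_const g h m (V : 'I_m.+1 -> C) :
  irreducible_poly g -> injective V -> (forall j, root g^C (V j)) ->
  (size g^C <= m.+2)%N ->
  (h^C).[V ord0] \in S <-> forall j, (h^C).[V j] = (h^C).[V ord0].
Proof.
move=> g_irr V_inj gV g_size; split=> [hS j|hV].
  have [c cE] : exists c : K, \val c = (h^C).[V ord0].
    by exists (Sub (h^C).[V ord0] hS); rewrite SubK.
  have hcE w : ((h - c%:P)^C).[w] = (h^C).[w] - (h^C).[V ord0].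
    by rewrite -cE /poly_in_C rmorphB /= map_polyC !hornerE.
  apply/eqP; rewrite -subr_eq0 -hcE -[_ == 0]/(root _ _).
  by apply: irreducible_root_conj (gV ord0) (gV j) _; rewrite // /root hcE subrr.
pose k := h %% g.
have g0 : g != 0 by rewrite -size_poly_gt0 ltnW //; case: g_irr.
have kV j : (k^C).[V j] = (h^C).[V j].
  rewrite [in RHS](divp_eq h g) /poly_in_C rmorphD rmorphM /= !hornerE.
  by rewrite (rootP (gV j)) mulr0 add0r.
have kE : k^C = ((h^C).[V ord0])%:P.
  apply/eqP; rewrite -subr_eq0; apply/eqP.
  apply: (@roots_geq_poly_eq0 _ _ (map V (enum 'I_m.+1))).
  - by apply/allP=> _ /mapP[j _ ->]; rewrite /root !hornerE kV hV subrr.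
  - by rewrite (map_inj_uniq V_inj) enum_uniq.
  rewrite size_map size_enum_ord (leq_trans (size_polyD _ _)) // geq_max.
  rewrite size_polyN size_polyC (leq_trans (leq_b1 _)) // andbT.
  rewrite -ltnS (leq_trans _ g_size) // /poly_in_C !size_map_poly.
  by rewrite ltn_modp.
have := congr1 (fun q : {poly C} => q`_0) kE.
by rewrite coefC eqxx coef_map => <-; apply: valP.
Qed.

End Conjugates.

Theorem proposition4p1 (R : realType) (S : {pred R[i]}) (K : subFieldType S)
    (n : nat) (p : {poly K}) (r : 'I_n -> R[i])
    (p_roots : has_distinct_roots p r)
    (a : 'I_n -> K) (a_resolvent : is_resolvent r a)
    (g : {poly K}) (g_irr : irreducible_poly g)
    (g_factor : poly_in_C g %| auxiliary_poly r a)
    (g_root : root (poly_in_C g) (lin_form a r))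
    (m : nat) (V : 'I_m.+1 -> R[i]) (V_inj : injective V)
    (V_ord0 : V ord0 = lin_form a r)
    (V_roots : forall z : R[i], root (poly_in_C g) z <-> exists j, V j = z)
    (F : 'I_n -> {ratio {poly K}})
    (F_def : forall i, ratio_defined (F i) (V ord0))
    (F_r : forall i, ratio_eval (F i) (V ord0) = r i) :
  (forall i j, ratio_defined (F i) (V j)) /\
  exists sigma : 'I_m.+1 -> 'S_n,
    [/\ forall j i, ratio_eval (F i) (V j) = r (sigma j i),
        is_galois_group K r [set sigma j | j : 'I_m.+1] &
        forall f : {ratio {mpoly K[n]}}, function_of_roots r f ->
          (known r f <-> forall j, invariant_under r f (sigma j)) /\
          (known r f <-> forall j,
             mratio_eval f (fun i => ratio_eval (F i) (V j)) = mratio_eval f r)].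
Proof.
have gV j : root (poly_in_C g) (V j) by apply/V_roots; exists j.
have transfer (h : {poly K}) j : root (poly_in_C h) (V ord0) -> root (poly_in_C h) (V j).
  exact: irreducible_root_conj g_irr (gV ord0) (gV j).
have /fin_all_exists[Q QP] : forall i : 'I_n, exists q : {poly K},
    forall w, root (poly_in_C g) w ->
    ratio_defined (F i) w /\ ratio_eval (F i) w = (poly_in_C q).[w].
  by move=> i; apply: ratio_eval_poly (F_def i).
have FE i j : ratio_eval (F i) (V j) = (poly_in_C (Q i)).[V j].
  by have [] := QP i _ (gV j).
have Q0 i : (poly_in_C (Q i)).[V ord0] = r i by rewrite -FE.
split=> [i j|]; first by have [] := QP i _ (gV j).
case: p_roots => p0 r_inj pE.
have pC_root z : root (poly_in_C p) z = (z \in codom r).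
  rewrite pE rootZ ?lead_coef_eq0 ?map_poly_eq0 //.
  by rewrite -(big_map r xpredT (fun y => 'X - y%:P)) root_prod_XsubC codomE enumT.
(* [p \Po Q i] vanishes at [V ord0], where [Q i] takes the value [r i]. *)
have row_root j i : (poly_in_C (Q i)).[V j] \in codom r.
  have := transfer (p \Po Q i) j.
  rewrite /poly_in_C map_comp_poly /root !horner_comp -!/(root _ _) !pC_root.
  by apply; rewrite Q0 codom_f.
(* A repetition in row [j] makes [g] divide [Q i - Q k], which carries the repetition back to row 0,
   that is, to [r] itself. *)
have row_inj j : injective (fun i => iinv (row_root j i)).
  move=> i k /(congr1 r); rewrite !f_iinv => Qik; apply/r_inj.
  have g_dvd : g %| Q i - Q k.
    apply: irreducible_root_dvdp (gV j) _ => //.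
    by rewrite /poly_in_C rmorphB /root !hornerE Qik subrr.
  have /dvdpP[q /(congr1 (fun q => (poly_in_C q).[V ord0]))] := g_dvd.
  rewrite /poly_in_C rmorphB rmorphM /= !hornerE (rootP (gV ord0)) mulr0 => /eqP.
  by rewrite subr_eq0 !Q0 => /eqP.
pose sigma j : 'S_n := perm (row_inj j).
have sigmaE j i : (poly_in_C (Q i)).[V j] = r (sigma j i).
  by rewrite permE f_iinv.
(* [g(a_1 Q_(s 1) + ... + a_n Q_(s n))] vanishes at [V_j] iff [s * sigma j] is
   in the table. *)
pose G (s : 'S_n) : {poly K} := g \Po (\sum_i (a i)%:P * Q (s i)).
have GE s j : (poly_in_C (G s)).[V j]
    = (poly_in_C g).[lin_form a (r \o (s * sigma j)%g)].
  rewrite /G /poly_in_C map_comp_poly horner_comp; congr _.[_].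
  rewrite rmorph_sum horner_sum; apply: eq_bigr => i _.
  by rewrite rmorphM hornerM /= map_polyC hornerC sigmaE /= permM.
(* The relation between [V ord0] and the roots is the vanishing of [L] at [V ord0], so it transfers
   to every row. *)
have V_lin j : V j = lin_form a (r \o sigma j).
  pose L : {poly K} := \sum_i (a i)%:P * Q i - 'X.
  have LE k : (poly_in_C L).[V k] = lin_form a (r \o sigma k) - V k.
    rewrite /poly_in_C rmorphB hornerD hornerN /= map_polyX hornerX.
    congr (_ - _); rewrite rmorph_sum horner_sum; apply: eq_bigr => i _.
    by rewrite rmorphM hornerM /= map_polyC hornerC sigmaE.
  have sigma0 : lin_form a (r \o sigma ord0) = V ord0.
    by rewrite V_ord0; apply: eq_bigr => i _; rewrite /= -sigmaE Q0.
  apply/esym/eqP; rewrite -subr_eq0 -LE; apply: (transfer L).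
  by rewrite /root LE sigma0 subrr.
(* Distinct permutations give distinct resolvent values, so membership in the table can be read off
   from [g]. *)
have rowP (s : 'S_n) :
    reflect (exists j, s = sigma j) (root (poly_in_C g) (lin_form a (r \o s))).
  apply: (iffP idP) => [/V_roots[j]|[j ->]]; last by rewrite -V_lin.
  by rewrite V_lin => /a_resolvent<-; exists j.
have sigma0 : sigma ord0 = 1%g.
  by apply/permP=> i; apply: r_inj; rewrite perm1 -sigmaE Q0.
have row_table (f : {ratio {mpoly K[n]}}) j :
    mratio_eval f (fun i => ratio_eval (F i) (V j)) = mratio_eval f (r \o sigma j).
  by apply: eq_mratio_eval => i /=; rewrite FE sigmaE.
have knownP (f : {ratio {mpoly K[n]}}) : function_of_roots r f ->
    known r f <-> forall j, invariant_under r f (sigma j).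
  move=> f_def.
  have fV : mratio_defined f (fun i => (poly_in_C (Q i)).[V ord0]).
    by rewrite (eq_mratio_defined f (y := r \o sigma ord0)) // => i; rewrite sigmaE.
  have [h hP] := mratio_eval_poly g_irr (gV ord0) fV.
  have hE j : (poly_in_C h).[V j] = mratio_eval f (r \o sigma j).
    by rewrite -hP //; apply: eq_mratio_eval => i /=; rewrite sigmaE.
  have h0 : (poly_in_C h).[V ord0] = mratio_eval f r.
    by rewrite hE; apply: eq_mratio_eval => i /=; rewrite sigma0 perm1.
  have g_size : (size (poly_in_C g) <= m.+2)%N.
    apply: (size_dvdp_prod_XsubC (V := V) a_resolvent g_factor).
    by move=> z /V_roots.
  have [h_const h_in] := conj_horner_const h g_irr V_inj gV g_size.
  rewrite /known /invariant_under -h0.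
  split=> [hS j|hV]; first by rewrite -hE h_const.
  by apply: h_in => j; rewrite hE hV.
exists sigma; split=> [j i||f f_def]; first by rewrite FE sigmaE.
  split.
    apply/group_setP; split=> [|s t /imsetP[k _ ->] /imsetP[j _ ->]].
      by rewrite -sigma0 imset_f.
    (* [G (sigma k)] vanishes at [V ord0], since row 0 is the identity and [V k] is a root of [g];
       transferring to [V j] gives the product. *)
    have /rowP[l ->] : root (poly_in_C g) (lin_form a (r \o (sigma k * sigma j)%g)).
      rewrite /root -GE; apply: transfer.
      by rewrite /root GE sigma0 mulg1 -V_lin; apply: gV.
    exact: imset_f.
  move=> s; split=> [/imsetP[j _ ->] f f_def /(knownP f f_def)|s_inv]; first exact.
  (* The function [f] of the roots is [g] applied to the resolvent. Its value at [r] is 0, hence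
     known, and its invariance under [s] says that [g] vanishes at the resolvent permuted by [s]. *)
  pose L : {mpoly K[n]} := \sum_i a i *: 'X_i.
  pose P : {mpoly K[n]} := \sum_(k < size g) g`_k *: L ^+ k.
  pose f : {ratio {mpoly K[n]}} := Ratio P 1.
  have f_def x : mratio_defined f x.
    by rewrite /mratio_defined /f denom_Ratio ?oner_neq0 // rmorph1 meval1 oner_neq0.
  have fE x : mratio_eval f x = (poly_in_C g).[lin_form a x].
    rewrite /mratio_eval /f !numden_Ratio ?oner_neq0 // rmorph1 meval1 divr1.
    have -> : lin_form a x = (map_mpoly (\val : K -> R[i]) L).@[x].
      rewrite [map_mpoly _ _]raddf_sum raddf_sum; apply: eq_bigr => i _.
      by rewrite /= map_mpolyZ mevalZ map_mpolyX mevalXU.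
    rewrite /poly_in_C horner_coef size_map_poly.
    rewrite [map_mpoly _ P]raddf_sum raddf_sum.
    apply: eq_bigr => k _.
    by rewrite /= map_mpolyZ mevalZ !rmorphXn coef_map.
  have g0 : mratio_eval f r = 0 by rewrite fE; apply/rootP.
  have /rowP[j ->] : root (poly_in_C g) (lin_form a (r \o s)).
    apply/rootP; rewrite -fE s_inv //.
    by have := valP (0 : K); rewrite /known g0 rmorph0.
  exact: imset_f.
split; first exact: knownP.
split=> [/(knownP f f_def) f_inv j|f_inv]; first by rewrite row_table; apply: f_inv.
by apply/(knownP f f_def) => j; rewrite /invariant_under -row_table.
Qed.
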